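(* Let $n \ge 2$ be an integer and let $l : \mathbb{F}_2^{n-1} \to \mathbb{F}_2$ be a linear function such that the recursion $s_{t+n} = s_t + l(s_{t+1},\dots,s_{t+n-1})$ generates a $(2^n-1)$-periodic binary sequence without a run of $n$ zeros. For an integer $k \ge 0$ let $N(l;k)$ be the number of functions $g : \mathbb{F}_2^{n-1} \to \mathbb{F}_2$ that generate a de Bruijn sequence of order $n$ and differ from $l$ at exactly $k$ points of $\mathbb{F}_2^{n-1}$. Then: 1. $N(l;1) = 1$. 2. $N(l;k) = 0$ for all even $k$. 3. For every odd $k$ with $3 \le k \le 2^{n-1}-1$, $$N(l;k) = \frac{(2^{n-1}-1)(2^{n-1}-2)\cdots(2^{n-1}-k+1)}{k!}.$$ 4. $N(l;2^{n-1}-1) = 1$. 5. $N(l;k) = 0$ for all $k > 2^{n-1}-1$. 6. $\displaystyle\sum_{k=1}^{2^{n-1}-1} N(l;k) = 2^{2^{n-1}-n}$.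
   Context: $\mathbb{F}_2=\{0,1\}$ is the binary field. A de Bruijn sequence of order $n$ is a (cyclic, i.e. periodically extended) sequence of length $2^n$ of elements of $\mathbb{F}_2$ in which all $2^n$ different binary $n$-tuples appear exactly once as $n$ consecutive terms. A function $f : \mathbb{F}_2^{n-1} \to \mathbb{F}_2$ generates a sequence $(s_t)$ if $s_{t+n} = s_t + f(s_{t+1},\dots,s_{t+n-1})$ for all $t \ge 0$, i.e. $(s_t)$ is produced by the non-singular feedback shift register with feedback function $F(x_0,\dots,x_{n-1}) = x_0 + f(x_1,\dots,x_{n-1})$. Thus $f$ generates a de Bruijn sequence of order $n$ exactly when the bijection $(x_0,\dots,x_{n-1}) \mapsto (x_1,\dots,x_{n-1},\, x_0 + f(x_1,\dots,x_{n-1}))$ of $\mathbb{F}_2^n$ is a single cycle of length $2^n$. The hypothesis on $l$ means that the corresponding shift register map permutes all $2^n-1$ nonzero states in a single cycle (the generated sequence is an $m$-sequence) and fixes the zero state. *)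

(* Defs.v *)
From mathcomp Require Import all_boot all_algebra.
From mathcomp Require Import boolp.

Set Implicit Arguments.
Unset Strict Implicit.
Unset Printing Implicit Defensive.

Import GRing.Theory.
Local Open Scope ring_scope.

(* Binary sequences are functions [nat -> 'F_2]; [window m s t] is the m-tuple
   (s_t, ..., s_(t+m-1)) of consecutive terms. *)
Definition window (m : nat) (s : nat -> 'F_2) (t : nat) : 'rV['F_2]_m :=
  \row_(i < m) s (t + i)%N.

Definition generates (n : nat) (f : 'rV['F_2]_n.-1 -> 'F_2)
    (s : nat -> 'F_2) : Prop :=
  forall t : nat, s (t + n)%N = s t + f (window n.-1 s t.+1).

Arguments generates : clear implicits.

Definition period (p : nat) (s : nat -> 'F_2) : Prop :=
  (0 < p)%N /\ forall t : nat, s (t + p)%N = s t.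

Definition least_period (p : nat) (s : nat -> 'F_2) : Prop :=
  period p s /\ forall q : nat, period q s -> (p <= q)%N.

(* A cyclic sequence of length 2^n is encoded by its periodic extension. *)
Definition de_bruijn (n : nat) (s : nat -> 'F_2) : Prop :=
  period (2 ^ n) s /\
  forall w : 'rV['F_2]_n, exists! t : 'I_(2 ^ n), window n s t = w.

Definition generates_de_bruijn (n : nat) (f : 'rV['F_2]_n.-1 -> 'F_2) : Prop :=
  exists s : nat -> 'F_2, generates n f s /\ de_bruijn n s.
Arguments generates_de_bruijn : clear implicits.

(* "(2^n-1)-periodic" refers to the least period: for n = 2 the
   function f = 0 generates the constant sequence 1, which satisfies
   s_(t+3) = s_t and has no run of two zeros but is not an m-sequence. *)
Definition generates_m_sequence (n : nat) (f : 'rV['F_2]_n.-1 -> 'F_2) : Prop :=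
  exists s : nat -> 'F_2,
    [/\ generates n f s, least_period (2 ^ n - 1) s
      & forall t : nat, window n s t <> 0].
Arguments generates_m_sequence : clear implicits.

Definition num_de_bruijn (n : nat) (l : 'rV['F_2]_n.-1 -> 'F_2) (k : nat) : nat :=
  #|[set g : {ffun 'rV['F_2]_n.-1 -> 'F_2} |
      `[< generates_de_bruijn n g >] && (#|[set x | g x != l x]| == k)]|.
Arguments num_de_bruijn : clear implicits.

(* Main.v *)
From HB Require Import structures.
Require Import Defs.
From mathcomp Require Import all_boot all_algebra all_fingroup.
(* [fingraph] again, so that [order] is the orbit length, not the one of [fingroup]. *)
From mathcomp Require Import fingraph.
From mathcomp Require Import boolp ring zify.

Set Implicit Arguments.
Unset Strict Implicit.
Unset Printing Implicit Defensive.

Import GRing.Theory Num.Theory.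
Local Open Scope ring_scope.

(* Write N = 2^(n-1), let P_S be the permutation matrix of the register with
   feedback l + 1_S, and let K_b be the average of the P_S when every point of
   F_2^(n-1) is put into S independently with probability b.  A point v in S
   perturbs P_0 by a rank one matrix, so det(X - P_S) is multi-affine in the
   indicator of S and
     sum_S b^|S| (1-b)^(N-|S|) det(X - P_S) = det(X - K_b).
   The derivative at 1 of det(X - P_S) is 2^n if P_S is a single cycle, and 0
   otherwise, since then (X-1)^2 divides it.  On the other side, as the register
   of l is linear, the Walsh-Hadamard transform turns K_b into a weighted
   permutation matrix: it fixes the zero character, cycles through the 2^n - 1
   others, and N of these carry the weight 1-2b, the rest 1.  Hence
     det(X - K_b) = (X-1) (X^(2^n-1) - (1-2b)^N).
   Comparing derivatives at 1 with b = y/(1+y) gives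
     2^n sum_k N(l;k) y^k = (1+y)^N - (1-y)^N. *)

(** * Determinants under rank one perturbations *)

Section RankOne.
Variable R : comNzRingType.

(** By a Schur complement, the determinant of [X + c *: (u *m w)] is that of the bordered matrix
    [Y c]. Only the first row of [Y c] involves [c], and affinely, so the determinant interpolates
    between [c = 0] and [c = 1]. *)
Lemma det_add_rank1 m (X : 'M[R]_m) (u : 'cV_m) (w : 'rV_m) (b : R) :
  \det (X + b *: (u *m w)) = (1 - b) * \det X + b * \det (X + u *m w).
Proof.
pose Y c : 'M[R]_(1 + m) := block_mx 1%:M (c *: w) (- u) X.
have detY c : \det (Y c) = \det (X + c *: (u *m w)).
  have -> : Y c = block_mx 1%:M 0 (- u) 1%:M
                *m block_mx 1%:M (c *: w) 0 (X + c *: (u *m w)).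
    rewrite mulmx_block !mul1mx !mul0mx mulmx1 !addr0 mulNmx.
    by rewrite -scalemxAr addrCA addNr addr0.
  by rewrite det_mulmx det_lblock det_ublock !det1 !mul1r.
rewrite -detY (@determinant_multilinear _ _ _ (Y 0) (Y 1) (lshift m ord0) (1 - b) b).
- by rewrite !detY scale0r addr0 scale1r.
- apply/rowP=> j; rewrite !mxE (unsplitK (inl _)) !mxE.
  by case: split => k; rewrite !mxE; ring.
- apply/matrixP=> i j; rewrite !mxE; case: split_ordP => k ek; last by rewrite !mxE.
  by have := neq_lift (lshift m ord0) i; rewrite ek (ord1 k) eqxx.
- apply/matrixP=> i j; rewrite !mxE; case: split_ordP => k ek; last by rewrite !mxE.
  by have := neq_lift (lshift m ord0) i; rewrite ek (ord1 k) eqxx.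
Qed.

(** Both sides are affine in each [b i], so each coordinate can be moved to 0 or 1, by induction on
    the number of coordinates that are neither. At a vertex of the cube only [S =
    [set i | b i == 1]] has nonzero weight. *)
Lemma det_add_sum_rank1 m (I : finType) (X : 'M[R]_m)
    (u : I -> 'cV[R]_m) (w : I -> 'rV[R]_m) (b : I -> R) :
  \det (X + \sum_i b i *: (u i *m w i)) =
  \sum_(S : {set I}) (\prod_i (if i \in S then b i else 1 - b i)) *
     \det (X + \sum_(i in S) u i *m w i).
Proof.
have [k] := ubnP #|[pred i | b i \notin [:: 0; 1]]|.
elim: k b => // k IHk b; rewrite ltnS => le_bk.
have [/existsP[a ab]|/existsPn b01] := boolP [exists i, b i \notin [:: 0; 1]].
  (* [b' c] is [b] with its coordinate at [a] replaced by [c]. *)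
  pose b' c i := if i == a then c else b i.
  have ltb' c : c \in [:: 0; 1] -> (#|[pred i | b' c i \notin [:: 0%R; 1%R]]| < k)%N.
    move=> c01; apply: leq_trans le_bk; apply: proper_card.
    apply/properP; split; last first.
      by exists a; rewrite inE // /b' eqxx c01.
    by apply/subsetP=> i; rewrite !inE /b'; case: (i == a); rewrite ?inE //; move: c01; rewrite !inE => ->.
  have Eb c : X + \sum_i b' c i *: (u i *m w i) =
     X + \sum_(i | i != a) b i *: (u i *m w i) + c *: (u a *m w a).
    rewrite (bigD1 a) //= {1}/b' eqxx -addrA [X in _ = _ + X]addrC; congr (_ + (_ + _)).
    by apply: eq_bigr => i /negPf ia; rewrite /b' ia.
  have bE i : b i = b' (b a) i by rewrite /b'; case: eqP => // ->.
  rewrite (eq_bigr (fun i => b' (b a) i *: (u i *m w i))); last by move=> i _; rewrite {1}bE.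
  rewrite Eb det_add_rank1 -[u a *m w a]scale1r -Eb.
  have -> : X + \sum_(i | i != a) b i *: (u i *m w i) = X + \sum_i b' 0 i *: (u i *m w i).
    by rewrite Eb scale0r addr0.
  rewrite !IHk ?ltb' ?inE ?eqxx ?orbT // !mulr_sumr -big_split; apply: eq_bigr => S _ /=.
  rewrite !mulrA -mulrDl; congr (_ * _).
  have PE c : \prod_i (if i \in S then b' c i else 1 - b' c i) =
      (if a \in S then c else 1 - c) *
      \prod_(i | i != a) (if i \in S then b i else 1 - b i).
    rewrite (bigD1 a) //= /b' eqxx; congr (_ * _).
    by apply: eq_bigr => i /negPf ->.
  rewrite !PE [\prod_i _](bigD1 a) //=.
  by case: (a \in S); ring.
have {}b01 i : b i = 0 \/ b i = 1.
  by have := b01 i; rewrite negbK !inE => /orP[] /eqP; [left | right].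
pose S0 := [set i | b i == 1].
have bS i : b i = (i \in S0)%:R.
  rewrite inE; case: (b01 i) => ->; last by rewrite eqxx.
  by rewrite eq_sym oner_eq0 mulr0n.
rewrite (bigD1 S0) //= [\prod_i _]big1 => [|i _]; last first.
  by rewrite bS; case: (i \in S0); rewrite ?mulr1n ?mulr0n ?subr0.
rewrite mul1r [\sum_(S | S != S0) _]big1 => [|S neS].
  rewrite addr0 [\sum_(i in S0) _]big_mkcond; congr (\det (X + _)); apply: eq_bigr => i _.
  by rewrite bS; case: (i \in S0); rewrite ?mulr1n ?mulr0n ?scale1r ?scale0r.
have [i neSi] : exists i, (i \in S) != (i \in S0).
  apply/existsP; apply: contraR neS => /existsPn eqS; apply/eqP/setP=> i.
  by apply/eqP; have := eqS i; rewrite negbK.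
rewrite (bigD1 i) //= bS; move: neSi.
by case: (i \in S); case: (i \in S0); rewrite ?mulr1n ?mulr0n ?subrr ?mul0r.
Qed.

End RankOne.

(** This is [det_add_sum_rank1] over the polynomial ring with constant weights; the sign of the
    perturbation in [X - A] is absorbed into [u']. *)
Lemma char_poly_add_sum_rank1 (R : comNzRingType) m (I : finType) (A : 'M[R]_m)
    (u : I -> 'cV[R]_m) (w : I -> 'rV[R]_m) (b : I -> R) :
  char_poly (A + \sum_i b i *: (u i *m w i)) =
  \sum_(S : {set I}) (\prod_i (if i \in S then b i else 1 - b i))%:P *
     char_poly (A + \sum_(i in S) u i *m w i).
Proof.
pose u' i := map_mx polyC (- u i); pose w' i := map_mx polyC (w i).
have uw' i : u' i *m w' i = - map_mx polyC (u i *m w i).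
  by rewrite map_mxM /= /u' map_mxN mulNmx.
rewrite /char_poly /char_poly_mx.
have -> : 'X%:M - map_mx polyC (A + \sum_i b i *: (u i *m w i)) =
   ('X%:M - map_mx polyC A) + \sum_i (b i)%:P *: (u' i *m w' i).
  rewrite map_mxD opprD addrA; congr (_ + _).
  rewrite raddf_sum -sumrN; apply: eq_bigr => i _.
  by rewrite /= map_mxZ uw' scalerN.
rewrite det_add_sum_rank1; apply: eq_bigr => S _; congr (_ * _).
  rewrite rmorph_prod; apply: eq_bigr => i _.
  by case: ifP => // _; rewrite rmorphB.
rewrite map_mxD opprD addrA; congr (\det (_ + _)).
by rewrite raddf_sum -sumrN; apply: eq_bigr => i _; rewrite uw'.
Qed.

(** * Determinants of weighted permutations with one nontrivial cycle *)

Section WeightedCycle.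

Lemma det_eq0_ker (F : fieldType) m (A : 'M[F]_m) (v : 'cV_m) :
  v != 0 -> A *m v = 0 -> \det A = 0.
Proof.
move=> v0 Av; rewrite -det_tr; apply/eqP/det0P; exists v^T.
  by rewrite -(inj_eq trmx_inj) trmxK trmx0.
by rewrite -trmx_mul Av trmx0.
Qed.

Variables (m : nat) (s : 'S_m).
Hypothesis s_neq1 : s != 1%g.
Hypothesis s_cycle : forall i j, s i != i -> s j != j -> exists k, iter k s i = j.

(** In the Leibniz expansion a permutation [p] contributes only if each [p i] is [i] or [s i]. Once
    such a [p] moves a point it must follow [s] along the whole cycle, which leaves only [1] and
    [s]. *)
Let det_sign (R : comNzRingType) (d : 'I_m -> R) (z : R) :
  \det (\matrix_(i, j) (z *+ (i == j) - d i *+ (s i == j))) =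
  \prod_(i | s i == i) (z - d i) *
   (z ^+ #|[pred i | s i != i]| + (-1) ^+ s * \prod_(i | s i != i) - d i).
Proof.
rewrite /determinant (bigD1 1%g) // (bigD1 s) //= [X in _ + (_ + X)]big1 ?addr0 => [|p /andP[p1 ps]].
  rewrite odd_perm1 mul1r mulrDr; congr (_ + _).
    rewrite (bigID (fun i => s i == i)) /=; congr (_ * _).
      by apply: eq_bigr => i /eqP si; rewrite mxE perm1 si eqxx.
    rewrite -prodr_const; apply: eq_big => [i|i /negPf si]; first by rewrite inE.
    by rewrite mxE perm1 eqxx si subr0.
  rewrite (bigID (fun i => s i == i)) /= mulrCA; congr (_ * (_ * _)).
    by apply: eq_bigr => i /eqP si; rewrite mxE si eqxx.
  by apply: eq_bigr => i /negPf si; rewrite mxE eqxx eq_sym si sub0r.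
suff [i /norP[pi1 pis]] : exists i, ~~ ((i == p i) || (s i == p i)).
  by rewrite (bigD1 i) //= mxE (negPf pi1) (negPf pis) subr0 mul0r mulr0.
apply/existsP; apply: contraR ps => /existsPn pP.
have {}pP i : p i = i \/ p i = s i.
  by have := pP i; rewrite negbK => /orP[] /eqP <-; [left | right].
have [i pi] : exists i, p i != i.
  apply/existsP; apply: contraR p1 => /existsPn p1; apply/eqP/permP=> i.
  by apply/eqP; have := p1 i; rewrite negbK perm1.
have pis : p i = s i by case: (pP i) pi => -> //; rewrite eqxx.
(* If [p] agrees with [s] at a point [y] of the cycle, it cannot fix [s y], since [s y] is already
   the image of [y]. *)
have pk k : p (iter k s i) = s (iter k s i) /\ s (iter k s i) != iter k s i.
  elim: k => [|k [IHk nek]] /=; first by rewrite -pis.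
  have nek' : s (s (iter k s i)) != s (iter k s i) by rewrite (inj_eq perm_inj).
  split=> //; case: (pP (s (iter k s i))) => // /eqP.
  by rewrite -{2}IHk (inj_eq perm_inj) (negPf nek).
apply/eqP/permP=> j; have [sj|sj] := eqVneq (s j) j.
  by case: (pP j) => ->.
have [k <-] : exists k, iter k s i = j by apply: s_cycle => //; rewrite -pis.
by case: (pk k).
Qed.

Let odd_cycle : odd_perm s = ~~ odd #|[pred i | s i != i]|.
Proof.
(* With d the indicator of the moved points and z = 1, this indicator is in the
   kernel, so [det_sign] vanishes. *)
have := @det_sign rat (fun i => (s i != i)%:R) 1.
rewrite (@det_eq0_ker _ _ _ (\col_i (s i != i)%:R)).
- rewrite big1 => [|i ->]; last by rewrite subr0.
  under eq_bigr => i -> do rewrite mulr1n.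
  rewrite mul1r expr1n prodr_const.
  have -> : #|(fun i => s i != i)| = #|[pred i | s i != i]| by apply: eq_card.
  rewrite -[_ ^+ #|_|]signr_odd -signr_addb.
  by case: (odd_perm s); case: (odd _).
- apply: contraNneq s_neq1 => /colP v0; apply/eqP/permP=> i; rewrite perm1.
  by have := v0 i; rewrite !mxE; have [->//|_ /eqP] := eqVneq (s i) i.
apply/colP=> i; rewrite !mxE (bigD1 i) //= !mxE eqxx.
have [si|si] := eqVneq (s i) i.
  rewrite !mulr0n mulr0 add0r big1 // => j /negPf ji.
  by rewrite !mxE si eqxx eq_sym ji !mul0rn subr0 mulr0n mul0r.
rewrite (bigD1 (s i)) //= !mxE eqxx (inj_eq perm_inj) si (eq_sym i) (negPf si).
rewrite big1 ?addr0 => [|j /andP[/negPf ji /negPf js]].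
  by rewrite !(mulr1n, mulr0n) sub0r !mulr1 subrr.
by rewrite !mxE (eq_sym i) ji (eq_sym _ j) js subr0 mul0r.
Qed.

(** By [odd_cycle], the sign of [s] times the sign from the factors [- d i] is always -1. *)
Lemma det_weighted_cycle (R : comNzRingType) (d : 'I_m -> R) (z : R) :
  \det (\matrix_(i, j) (z *+ (i == j) - d i *+ (s i == j))) =
  \prod_(i | s i == i) (z - d i) *
   (z ^+ #|[pred i | s i != i]| - \prod_(i | s i != i) d i).
Proof.
rewrite det_sign prodrN mulrA odd_cycle; congr (_ * (_ + _)).
have -> : #|(fun i => s i != i)| = #|[pred i | s i != i]| by apply: eq_card.
rewrite -[_ ^+ #|_|]signr_odd -signr_addb addNb addbb expr1 mulN1r.
by congr (- _).
Qed.

End WeightedCycle.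

(** * Matrices and characteristic polynomials indexed by a finite type *)

Section FinTypeMatrix.
Variable T : finType.

Definition fmx (R : Type) (F : T -> T -> R) : 'M[R]_#|T| :=
  \matrix_(i, j) F (enum_val i) (enum_val j).

Lemma big_enum_valT (R : Type) (idx : R) (op : SemiGroup.com_law R)
    (P : pred T) (F : T -> R) :
  \big[op/idx]_(i < #|T| | P (enum_val i)) F (enum_val i) = \big[op/idx]_(x | P x) F x.
Proof.
rewrite (reindex enum_rank) /=; last exact/onW_bij/enum_rank_bij.
by apply: eq_big => [x|x _]; rewrite enum_rankK.
Qed.

Lemma eq_fmx (R : Type) (F G : T -> T -> R) : F =2 G -> fmx F = fmx G.
Proof. by move=> FG; apply/matrixP=> i j; rewrite !mxE. Qed.

Lemma mul_fmx (R : pzSemiRingType) (F G : T -> T -> R) :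
  fmx F *m fmx G = fmx (fun x y => \sum_z F x z * G z y).
Proof.
apply/matrixP=> i j; rewrite !mxE -big_enum_valT.
by apply: eq_bigr => k _; rewrite !mxE.
Qed.

Lemma tr_fmx (R : Type) (F : T -> T -> R) : (fmx F)^T = fmx (fun x y => F y x).
Proof. by apply/matrixP=> i j; rewrite !mxE. Qed.

Lemma char_poly_mx_fmx (R : nzRingType) (F : T -> T -> R) :
  char_poly_mx (fmx F) = fmx (fun x y => 'X *+ (x == y) - (F x y)%:P).
Proof. by apply/matrixP=> i j; rewrite !mxE (inj_eq enum_val_inj). Qed.

Lemma det_fmx_eq0 (F : fieldType) (G : T -> T -> F) (v : T -> F) x0 :
  v x0 != 0 -> (forall x, \sum_y G x y * v y = 0) -> \det (fmx G) = 0.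
Proof.
move=> v0 Gv; apply: (@det_eq0_ker _ _ _ (\col_i v (enum_val i))).
  by apply: contraNneq v0 => /colP/(_ (enum_rank x0)); rewrite !mxE enum_rankK => ->.
apply/colP=> i; rewrite !mxE -[RHS](Gv (enum_val i)) -big_enum_valT.
by apply: eq_bigr => j _; rewrite !mxE.
Qed.

Section CharPoly.
Variables (f : T -> T).
Hypothesis f_inj : injective f.

(** Transport of [det_weighted_cycle] along [enum_rank]. Fixed points are allowed because the action
    of a linear register on characters fixes the zero character. *)
Lemma char_poly_weighted_cycle (R : comNzRingType) (d : T -> R) x0 :
  f x0 != x0 ->
  (forall x y, f x != x -> f y != y -> exists k, iter k f x = y) ->
  char_poly (fmx (fun x y => d x *+ (f x == y))) =
  \prod_(x | f x == x) ('X - (d x)%:P) *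
   ('X^#|[pred x | f x != x]| - (\prod_(x | f x != x) d x)%:P).
Proof.
move=> fx0 fcyc.
have g_inj : injective (fun i : 'I_#|T| => enum_rank (f (enum_val i))).
  by move=> i j /enum_rank_inj /f_inj /enum_val_inj.
pose s := perm g_inj.
have sE i : s i = enum_rank (f (enum_val i)) by rewrite permE.
have s_fix i : (s i == i) = (f (enum_val i) == enum_val i).
  by rewrite sE -{2}[i]enum_valK (inj_eq enum_rank_inj).
have iter_s k i : iter k s i = enum_rank (iter k f (enum_val i)).
  by elim: k => [|k IHk] /=; rewrite ?enum_valK // IHk sE enum_rankK.
have s1 : s != 1%g.
  by apply: contraNneq fx0 => /permP/(_ (enum_rank x0))/eqP; rewrite perm1 s_fix enum_rankK.
have scyc i j : s i != i -> s j != j -> exists k, iter k s i = j.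
  rewrite !s_fix => /fcyc fi /fi[k fk].
  by exists k; rewrite iter_s fk enum_valK.
rewrite /char_poly char_poly_mx_fmx.
have := det_weighted_cycle s1 scyc (fun i => (d (enum_val i))%:P) 'X.
have -> : \matrix_(i, j) ('X *+ (i == j) - (d (enum_val i))%:P *+ (s i == j)) =
   fmx (fun x y => 'X *+ (x == y) - (d x *+ (f x == y))%:P).
  apply/matrixP=> i j; rewrite !mxE polyCMn (inj_eq enum_val_inj); congr (_ - _ *+ _).
  by rewrite sE -{1}[j]enum_valK (inj_eq enum_rank_inj).
move=> ->; congr (_ * (_ - _)).
- by rewrite -[RHS]big_enum_valT; apply: eq_bigl.
- congr ('X ^+ _); rewrite -(card_image (@enum_val_inj _ T)); apply: eq_card => x.
  apply/imageP/idP=> [[i]|]; rewrite !inE ?s_fix; first by move=> fi ->.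
  by move=> fx; exists (enum_rank x); rewrite ?inE ?s_fix enum_rankK.
rewrite rmorph_prod -[RHS]big_enum_valT.
by apply: eq_bigl => i; rewrite s_fix.
Qed.

Lemma deriv_char_poly_invariant (R : fieldType) (A : {set T}) x0 x1 :
  (forall x, (f x \in A) = (x \in A)) -> x0 \in A -> x1 \notin A ->
  (char_poly (fmx (fun x y => (f x == y)%:R : R)))^`().[1] = 0.
Proof.
(* The matrix is block diagonal along A and its complement, and the determinants
   of both blocks vanish at 1. *)
move=> fA x0A x1A; rewrite /char_poly char_poly_mx_fmx.
set G := fun x y => _.
pose GA (B : {set T}) x y := if x \in B then G x y else (x == y)%:R : {poly R}.
have fB (B : {set T}) x : (forall x, (f x \in B) = (x \in B)) -> x \in B -> (\det (fmx (GA B))).[1] = 0.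
  move=> fB xB; rewrite -/(horner_eval 1 _) -det_map_mx.
  have -> : map_mx (horner_eval 1) (fmx (GA B)) =
     fmx (fun x y => if x \in B then (x == y)%:R - (f x == y)%:R else (x == y)%:R).
    apply/matrixP=> i j; rewrite !mxE /GA /G /horner_eval; case: ifP => _.
      by rewrite hornerD hornerN hornerMn hornerX hornerC.
    by rewrite hornerMn hornerC.
  (* As [B] is invariant under [f], its indicator lies in the kernel of the block evaluated at 1. *)
  apply: (@det_fmx_eq0 _ _ (fun x => (x \in B)%:R) x); first by rewrite xB oner_eq0.
  move=> y; have [yB|yB] := boolP (y \in B).
    under eq_bigr => z _ do rewrite mulrBl.
    rewrite sumrB (bigD1 y) //= big1 => [|z /negPf zy]; last by rewrite eq_sym zy mul0r.
    rewrite [X in _ - X](bigD1 (f y)) //= big1 => [|z /negPf zy]; last by rewrite eq_sym zy mul0r.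
    by rewrite !eqxx fB yB !addr0 subrr.
  rewrite (bigD1 y) //= big1 => [|z /negPf zy]; last by rewrite eq_sym zy mul0r.
  by rewrite eqxx (negPf yB) mulr0 addr0.
have GAin (B : {set T}) x y : x \in B -> GA B x y = G x y by move=> xB; rewrite /GA xB.
have GAout (B : {set T}) x y : x \notin B -> GA B x y = (x == y)%:R by move=> xB; rewrite /GA (negPf xB).
have G0 x y : (x \in A) != (y \in A) -> G x y = 0.
  move=> xy; have nxy : (x == y) = false by apply: contraNF xy => /eqP <-.
  have nfxy : (f x == y) = false by apply: contraNF xy => /eqP <-; rewrite fA.
  by rewrite /G nxy nfxy !mulr0n polyC0 subr0.
have GE : fmx G = fmx (GA A) *m fmx (GA (~: A)).
  rewrite mul_fmx; apply: eq_fmx => x y; have [xA|xA] := boolP (x \in A).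
    have [yA|yA] := boolP (y \in A); last first.
      rewrite G0 ?xA ?(negPf yA) // big1 // => z _; rewrite GAin //.
      have [zA|zA] := boolP (z \in A); last by rewrite G0 ?xA ?(negPf zA) // mul0r.
      by rewrite GAout ?inE ?negbK // (_ : z == y = false) ?mulr0 //; apply: contraNF yA => /eqP <-.
    rewrite (bigD1 y) //= big1 => [|z /negPf zy].
      by rewrite addr0 GAin // GAout ?inE ?negbK // eqxx mulr1.
    rewrite GAin //; have [zA|zA] := boolP (z \in A); last by rewrite G0 ?xA ?(negPf zA) // mul0r.
    by rewrite GAout ?inE ?negbK // zy mulr0.
  rewrite (bigD1 x) //= big1 => [|z /negPf zx]; last by rewrite GAout // eq_sym zx mul0r.
  by rewrite GAout // eqxx mul1r addr0 GAin ?inE.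
(* In each term of the product rule one determinant remains underived, and it vanishes at 1. *)
rewrite GE det_mulmx derivM hornerD !hornerM (fB A x0) // (fB _ x1) ?inE //.
  by rewrite mulr0 mul0r addr0.
by move=> x; rewrite !inE fA.
Qed.

End CharPoly.

End FinTypeMatrix.

(** * Detecting transitivity of a permutation *)

Section Orbits.
Variables (T : finType) (f : T -> T).
Hypothesis f_inj : injective f.

(** If [f] is transitive the characteristic polynomial is ['X^#|T| - 1]; otherwise the orbit of some
    [x] is a proper invariant set. The bound on [#|T|] makes a transitive [f] move every point, as
    [char_poly_weighted_cycle] asks. *)
Lemma deriv_char_poly_perm (R : fieldType) : (1 < #|T|)%N ->
  (char_poly (fmx (fun x y => (f x == y)%:R : R)))^`().[1] =
  if [forall x, forall y, fconnect f x y] then #|T|%:R else 0.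
Proof.
move=> T_gt1; case: ifPn => [/forallP ftrans|]; last first.
  case/forallPn=> x /forallPn[y xy].
  apply: (@deriv_char_poly_invariant _ _ _ [set z | fconnect f x z] x y).
  - by move=> z; rewrite !inE -same_fconnect1_r.
  - by rewrite inE connect0.
  by rewrite inE.
have fcyc x y : exists k, iter k f x = y.
  by exists (findex f x y); apply: iter_findex; apply/forallP: y.
have nofix x : f x != x.
  apply/eqP=> fx; suff: #|T| = 1%N by move=> T1; rewrite T1 in T_gt1.
  rewrite -cardsT -(cards1 x); congr #|pred_of_set _|; apply/setP=> y; rewrite !inE.
  have [k <-] := fcyc x y; apply/esym/eqP.
  by elim: k => //= k ->.
have [x0 _] : exists x0 : T, x0 \in T by apply/card_gt0P; apply: ltnW.
rewrite (char_poly_weighted_cycle f_inj (fun=> 1) (nofix x0)); last by move=> *; apply: fcyc.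
rewrite big_pred0 => [|x]; last exact/negbTE/nofix.
rewrite big1 // mul1r derivB derivXn derivC subr0 hornerMn hornerXn expr1n.
by congr _%:R; apply: eq_card => x; rewrite !inE nofix.
Qed.

(** The orbit of [x] avoids the fixed point [x0] and has at least [#|T|.-1] elements, so it fills
    the complement of [x0]. *)
Lemma order_transitive_off x0 :
  f x0 = x0 -> (forall x k, x != x0 -> (0 < k < #|T|.-1)%N -> iter k f x != x) ->
  forall x y, x != x0 -> y != x0 -> fconnect f x y.
Proof.
move=> fx0 fk x y xx0 yx0.
have le_ord : (#|T|.-1 <= order f x)%N.
  rewrite leqNgt; apply/negP=> lt_ord; have := fk _ _ xx0 (introT andP (conj _ lt_ord)).
  by rewrite order_gt0 iter_order // eqxx => /(_ isT).
have sub : fconnect f x \subset predC1 x0.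
  apply/subsetP=> z; rewrite !inE; apply: contraL => /eqP ->.
  apply/negP; rewrite fconnect_sym // => /iter_findex x0x; case/eqP: xx0.
  by rewrite -x0x; elim: (findex _ _ _) => //= k ->.
have := subset_cardP _ sub; rewrite cardC1 => /(_ _)/(_ y); rewrite !inE yx0 => -> //.
by apply/eqP; rewrite eqn_leq le_ord -(cardC1 x0) subset_leq_card.
Qed.

End Orbits.

(** * Shift registers and de Bruijn sequences *)

Section Register.
Variable m : nat.
Notation T := 'rV['F_2]_m.+1.
Notation V := 'rV['F_2]_m.

Definition tail (x : T) : V := \row_i x 0 (lift ord0 i).

(** An index other than the last is [lift ord_max j], with value [j], and receives the old
    coordinate [lift ord0 j], with value [j + 1]. *)
Definition step (f : V -> 'F_2) (x : T) : T :=
  \row_i (if unlift ord_max i is Some j then x 0 (lift ord0 j)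
          else x 0 ord0 + f (tail x)).

Lemma card_state k : #|{: 'rV['F_2]_k}| = (2 ^ k)%N.
Proof. by rewrite card_mx card_Fp // mul1n. Qed.

Lemma step_max f x : step f x 0 ord_max = x 0 ord0 + f (tail x).
Proof. by rewrite mxE unlift_none. Qed.

Lemma step_lift f x j : step f x 0 (lift ord_max j) = x 0 (lift ord0 j).
Proof. by rewrite mxE liftK. Qed.

Lemma step_inj f : injective (step f).
Proof.
move=> x y /rowP xy; have tl j : x 0 (lift ord0 j) = y 0 (lift ord0 j).
  by rewrite -!(step_lift f).
apply/rowP=> i; case: (unliftP ord0 i) => [j ->|->] //.
have := xy ord_max; rewrite !step_max.
have -> : tail x = tail y by apply/rowP=> j; rewrite !mxE.
exact: addIr.
Qed.

Lemma window_succ f s t :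
  generates m.+1 f s -> window m.+1 s t.+1 = step f (window m.+1 s t).
Proof.
move=> gs; apply/rowP=> i; case: (unliftP ord_max i) => [j ->|->].
  by rewrite step_lift !mxE lift_max lift0 addSnnS.
rewrite step_max !mxE addn0 addSnnS gs; congr (_ + f _).
by apply/rowP=> j; rewrite !mxE lift0 addSnnS.
Qed.

Lemma window_iter f s t k :
  generates m.+1 f s -> window m.+1 s (t + k) = iter k (step f) (window m.+1 s t).
Proof.
move=> gs; elim: k => [|k IHk]; first by rewrite addn0.
by rewrite addnS (window_succ _ gs) IHk.
Qed.

Definition orbit_seq (f : V -> 'F_2) (x : T) (t : nat) : 'F_2 :=
  (iter t (step f) x) 0 ord0.

Lemma window_orbit_seq f x t : window m.+1 (orbit_seq f x) t = iter t (step f) x.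
Proof.
apply/rowP=> -[i lt_i]; rewrite mxE /=.
elim: i t lt_i => [|i IHi] t lt_i.
  by rewrite addn0 /orbit_seq; congr (fun_of_matrix _ _ _); apply: val_inj.
rewrite -addSnnS (IHi _ (ltnW lt_i)) /=.
have -> : Ordinal (ltnW lt_i) = lift ord_max (Ordinal (lt_i : (i < m)%N)).
  by apply: val_inj; rewrite /= /bump leqNgt (lt_i : (i < m)%N).
by rewrite step_lift; congr (fun_of_matrix _ _ _); apply: val_inj.
Qed.

Lemma orbit_seq_generates f x : generates m.+1 f (orbit_seq f x).
Proof.
move=> t; have := window_orbit_seq f x t.+1.
move/rowP/(_ ord_max); rewrite mxE addSnnS => ->; rewrite /= step_max.
congr (_ + f _); rewrite -window_orbit_seq.
by apply/rowP=> j; rewrite !mxE lift0 addSnnS.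
Qed.

(** The windows of a generated sequence form an orbit of [step f], so meeting every window exactly
    once in a period means that this orbit is everything. *)
Lemma generates_de_bruijn_transitive (f : V -> 'F_2) :
  generates_de_bruijn m.+1 f <-> [forall x, forall y, fconnect (step f) x y].
Proof.
have inj := @step_inj f.
split=> [[s [gs [[_ per] bij]]]|/forallP ftrans].
  apply/forallP=> x; apply/forallP=> y.
  have [t [<- _]] := bij x; have [t' [<- _]] := bij y.
  (* Going once around the period gives a nonnegative number of steps from [t] to [t'] without
     comparing them. *)
  have <- : window m.+1 s (t + (2 ^ m.+1 - t + t')) = window m.+1 s t'.
    have lt_t := ltnW (ltn_ord t).
    rewrite addnA (subnKC lt_t) addnC.
    by apply/rowP=> i; rewrite !mxE addnAC per.
  by rewrite (window_iter _ _ gs) fconnect_iter.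
have fconn x y : fconnect (step f) x y by apply/forallP: y.
have ordE x : order (step f) x = (2 ^ m.+1)%N.
  by rewrite -card_state; apply: eq_card => y; rewrite !inE; apply: fconn.
pose x0 : T := 0; exists (orbit_seq f x0); split; first exact: orbit_seq_generates.
split.
  split=> [|t]; first by rewrite expn_gt0.
  by rewrite /orbit_seq iterD -(ordE x0) iter_order.
move=> w; have lt_w : (findex (step f) x0 w < 2 ^ m.+1)%N by rewrite -(ordE x0) findex_max.
exists (Ordinal lt_w); split; first by rewrite window_orbit_seq /= iter_findex.
move=> t; rewrite window_orbit_seq => tw; apply: val_inj => /=.
by rewrite -tw findex_iter // ordE.
Qed.

End Register.

(** * Characters of binary vector spaces and the Walsh-Hadamard matrix *)

Lemma F2_addxx (V : lmodType 'F_2) (x : V) : x + x = 0.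
Proof. by rewrite -[x]scale1r -scalerDl (_ : 1 + 1 = 0 :> 'F_2) ?scale0r //; apply: val_inj. Qed.

Lemma F2_cases (a : 'F_2) : a = 0 \/ a = 1.
Proof. by case: a => -[|[|//]] i; [left | right]; apply: val_inj. Qed.

(** The nontrivial additive character of the binary field, with rational values. *)
Definition sgn2 (a : 'F_2) : rat := (-1) ^+ (a : nat).

Lemma sgn2_0 : sgn2 0 = 1. Proof. by []. Qed.

Lemma sgn2_1 : sgn2 1 = -1. Proof. by []. Qed.

Lemma sgn2D a b : sgn2 (a + b) = sgn2 a * sgn2 b.
Proof.
have [->|->] := F2_cases a; rewrite ?add0r ?sgn2_0 ?mul1r //.
by have [->|->] := F2_cases b; rewrite ?addr0 ?sgn2_0 ?mulr1 // (F2_addxx (1 : 'F_2^o)).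
Qed.

Section Walsh.
Variable k : nat.
Notation T := 'rV['F_2]_k.

Definition dot2 (x y : T) : 'F_2 := (x *m y^T) 0 0.

Lemma dot2Dl x y z : dot2 (x + y) z = dot2 x z + dot2 y z.
Proof. by rewrite /dot2 mulmxDl mxE. Qed.

Lemma dot2Dr x y z : dot2 x (y + z) = dot2 x y + dot2 x z.
Proof. by rewrite /dot2 linearD mulmxDr mxE. Qed.

Lemma dot2_deltar x i : dot2 x (delta_mx 0 i) = x 0 i.
Proof. by rewrite /dot2 trmx_delta -colE mxE. Qed.

Lemma dot2_deltal x i : dot2 (delta_mx 0 i) x = x 0 i.
Proof. by rewrite /dot2 -rowE !mxE. Qed.

Definition walsh : 'M[rat]_#|{: T}| := fmx (fun x y : T => sgn2 (dot2 x y)).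

Lemma sum_walsh (x : T) : \sum_y sgn2 (dot2 x y) = #|{: T}|%:R *+ (x == 0).
Proof.
have [->|x0] := eqVneq x 0.
  rewrite (eq_bigr (fun=> 1)) ?sumr_const // => y _.
  by rewrite /dot2 mul0mx mxE.
have [i xi] : exists i, x 0 i != 0.
  apply/existsP; apply: contraR x0 => /existsPn x0; apply/eqP/rowP=> i.
  by apply/eqP; have := x0 i; rewrite negbK mxE.
have {}xi : x 0 i = 1 by case: (F2_cases (x 0 i)) xi => ->.
rewrite mulr0n; set S := \sum_y _.
(* Translating [y] by the basis vector at a coordinate where [x] is 1 flips every sign. *)
have SN : S = - S.
  rewrite {1}/S (reindex_inj (addIr (delta_mx 0 i))) /= -sumrN.
  by apply: eq_bigr => y _; rewrite dot2Dr sgn2D dot2_deltar xi sgn2_1 mulrN1.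
by apply/eqP; move/eqP: SN; rewrite -addr_eq0 -mulr2n mulrn_eq0.
Qed.

(** Orthogonality of characters makes [walsh *m walsh^T] a nonzero scalar matrix. *)
Lemma det_walsh_neq0 : \det walsh != 0.
Proof.
have : \det (walsh *m walsh^T) != 0.
  have -> : walsh *m walsh^T = (#|{: T}|%:R)%:M.
    rewrite tr_fmx mul_fmx; apply/matrixP=> i j; rewrite !mxE.
    under eq_bigr => z _ do rewrite -sgn2D -dot2Dl.
    rewrite sum_walsh addr_eq0 (_ : - enum_val j = enum_val j) ?(inj_eq enum_val_inj) //.
    by apply/esym/eqP; rewrite -addr_eq0 F2_addxx.
  rewrite det_scalar expf_neq0 // pnatr_eq0 -lt0n; apply/card_gt0P; by exists 0.
by apply: contraNneq => d0; rewrite det_mulmx d0 mul0r.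
Qed.

(** Translation by the basis vector at [i] exchanges the vectors with [i]-th coordinate 0 and 1. *)
Lemma card_coord_neq0 (i : 'I_k) : #|[pred x : T | x 0 i != 0]|.*2 = (2 ^ k)%N.
Proof.
rewrite -card_state -(cardC [pred x : T | x 0 i != 0]) -addnn; congr (_ + _)%N.
rewrite -(card_imset _ (addIr (delta_mx 0 i : T))); apply: eq_card => x.
have D y : ((y + delta_mx 0 i : T) 0 i == 0) = (y 0 i != 0).
  by rewrite !mxE !eqxx; case: (F2_cases (y 0 i)) => ->.
rewrite !inE negbK; apply/imsetP/idP => [[y]|xi]; first by rewrite inE => yi ->; rewrite D.
exists (x + delta_mx 0 i); last by rewrite -addrA F2_addxx addr0.
by rewrite inE D negbK.
Qed.

End Walsh.

(** * The linear register, its dual action and its perturbations *)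

Section LinearRegister.
Variables (m : nat) (l : {linear 'rV['F_2]_m -> ('F_2)^o}).
Notation T := 'rV['F_2]_m.+1.
Notation V := 'rV['F_2]_m.

Lemma tail_is_linear : linear (@tail m).
Proof. by move=> a x y; apply/rowP=> i; rewrite !mxE. Qed.

Lemma step_is_linear : linear (step l).
Proof.
move=> a x y; apply/rowP=> i; case: (unliftP ord_max i) => [j ->|->].
  by rewrite step_lift !mxE liftK.
rewrite step_max tail_is_linear linearP !mxE unlift_none /= mulrDr.
by rewrite addrACA.
Qed.

HB.instance Definition _ :=
  GRing.isLinear.Build 'F_2 T T *:%R (step l) step_is_linear.

Definition step_mx : 'M['F_2]_m.+1 := lin1_mx (step l).

Lemma iter_step k x : iter k (step l) x = x *m (step_mx ^+ k).
Proof.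
elim: k => [|k IHk]; first by rewrite expr0 mulmx1.
by rewrite iterS IHk exprSr mulmxA mul_rV_lin1.
Qed.

(** The adjoint of [step l] for [dot2], that is, the action of the register on characters. *)
Definition costep (x : T) : T := x *m step_mx^T.

Lemma dot2_costep x y : dot2 (step l x) y = dot2 x (costep y).
Proof.
by rewrite /dot2 /costep trmx_mul trmxK mulmxA mul_rV_lin1.
Qed.

Lemma iter_costep k x : iter k costep x = x *m (step_mx ^+ k)^T.
Proof.
elim: k => [|k IHk]; first by rewrite expr0 trmx1 mulmx1.
by rewrite iterS IHk exprS trmx_mul mulmxA.
Qed.

Hypothesis m_gt0 : (0 < m)%N.
Hypothesis l_mseq : generates_m_sequence m.+1 l.

Lemma card_T1 : #|{: T}|.-1 = (2 ^ m.+1 - 1)%N.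
Proof. by rewrite card_state subn1. Qed.

(** The orbit of one window of the m-sequence avoids 0 and, by minimality of the period, has at
    least [2 ^ m.+1 - 1] elements. It therefore contains every nonzero state, and all of them have
    this order. *)
Lemma iter_step_neq (x : T) k :
  x != 0 -> (0 < k < #|{: T}|.-1)%N -> iter k (step l) x != x.
Proof.
have inj := @step_inj m l.
have [s [gs [[_ _] minp] s0]] := l_mseq.
pose w := window m.+1 s 0.
have ws t : window m.+1 s t = iter t (step l) w by rewrite -(window_iter _ _ gs) add0n.
have le_ord : (#|{: T}|.-1 <= order (step l) w)%N.
  rewrite card_T1; apply: minp; split; first exact: order_gt0.
  move=> t; have := ws (t + order (step l) w)%N.
  rewrite iterD iter_order // -ws => /rowP/(_ ord0).
  by rewrite !mxE !addn0.
have sub : fconnect (step l) w \subset predC1 0.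
  apply/subsetP=> z /iter_findex <-; rewrite !inE; apply/eqP => z0.
  by apply: (s0 (findex (step l) w z)); rewrite ws.
have ord_w : order (step l) w = #|{: T}|.-1.
  by apply/eqP; rewrite eqn_leq le_ord -(cardC1 (0 : T)) subset_leq_card.
move=> x0 /andP[k_gt0 lt_k]; apply/eqP=> xk.
have wx : fconnect (step l) w x.
  have := subset_cardP _ sub; rewrite cardC1 => /(_ ord_w)/(_ x).
  by rewrite !inE x0.
have ord_x : order (step l) x = #|{: T}|.-1.
  by rewrite -ord_w; apply: eq_card => y; rewrite !inE (same_connect (fconnect_sym inj) wx).
(* Below the order, [findex] returns the exponent [k] itself, while a return to [x] would make it
   0. *)
have := findex_iter (i := k) (x := x) (f := step l).
rewrite ord_x xk findex0 => /(_ lt_k) k0.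
by rewrite -k0 in k_gt0.
Qed.

(** [step_mx ^+ k - 1] and its transpose are singular together, so a nonzero vector fixed by the
    dual power would yield one fixed by the register. *)
Lemma iter_costep_neq (x : T) k :
  x != 0 -> (0 < k < #|{: T}|.-1)%N -> iter k costep x != x.
Proof.
move=> x0 lt_k; rewrite iter_costep; apply: contraNneq x0 => xk.
have : \det (step_mx ^+ k - 1%:M) != 0.
  apply/det0P => -[v v0]; rewrite mulmxBr mulmx1 -iter_step => /eqP.
  by rewrite subr_eq0 (negPf (iter_step_neq v0 lt_k)).
apply: contraNT => x0; rewrite -det_tr; apply/det0P; exists x => //.
by rewrite linearB /= trmx1 mulmxBr xk mulmx1 subrr.
Qed.

Lemma costep0 : costep 0 = 0. Proof. by rewrite /costep mul0mx. Qed.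

Lemma costep_inj : injective costep.
Proof.
move=> x y xy; apply/eqP; rewrite -subr_eq0; apply: contraT => nxy.
have : \det step_mx^T = 0.
  by apply/eqP/det0P; exists (x - y) => //; rewrite mulmxBl; apply/eqP; rewrite subr_eq0; apply/eqP.
rewrite det_tr => /eqP/det0P[v /eqP v0 vA]; case: v0; apply: (@step_inj _ l).
by rewrite -[RHS](mul_rV_lin1 (step l)) mul0mx -[LHS](mul_rV_lin1 (step l)).
Qed.

Lemma costep_transitive (x y : T) : x != 0 -> y != 0 -> fconnect costep x y.
Proof. exact: (order_transitive_off costep_inj costep0 iter_costep_neq). Qed.

Lemma costep_fix x : (costep x == x) = (x == 0).
Proof.
apply/idP/idP=> [|/eqP ->]; last by rewrite costep0.
apply: contraLR => x0; apply: (iter_costep_neq (k := 1) x0).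
(* The exponent 1 is in range because [m > 0] gives [2 ^ m.+1 - 1 > 1]. *)
by rewrite card_T1 /= ltn_subRL addn1 (ltn_exp2l 1).
Qed.

Let e : T := delta_mx 0 ord_max.

(** The matrix [K_b]: row [x] of a perturbed register depends only on whether [tail x] is in [S], so
    on average the successor is shifted by [e] with weight [b]. *)
Definition mixed_mx (b : rat) : 'M_#|{: T}| :=
  fmx (fun x y => (1 - b) *+ (step l x == y) + b *+ (step l x + e == y)).

(** [mixed_mx b] sends column [z] of [walsh] to [d z] times column [costep z], so it is similar to
    the transpose of a weighted permutation matrix. *)
Lemma char_poly_mixed_mx b :
  char_poly (mixed_mx b) =
  ('X - 1) * ('X^(2 ^ m.+1 - 1) - ((1 - b *+ 2) ^+ (2 ^ m))%:P).
Proof.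
(* [d z] is [(1 - b) + b * sgn2 (z 0 ord_max)], the average effect of adding [e] on the character of
   [z]. *)
pose d (z : T) : rat := if z 0 ord_max == 0 then 1 else 1 - b *+ 2.
pose W := fmx (fun z z' : T => d z *+ (costep z == z')).
have KH : mixed_mx b *m walsh m.+1 = walsh m.+1 *m W^T.
  rewrite tr_fmx !mul_fmx; apply: eq_fmx => x z.
  have -> : \sum_y ((1 - b) *+ (step l x == y) + b *+ (step l x + e == y)) * sgn2 (dot2 y z) =
     (1 - b) * sgn2 (dot2 (step l x) z) + b * sgn2 (dot2 (step l x + e) z).
    under eq_bigr => y _ do rewrite mulrDl.
    rewrite big_split /= (bigD1 (step l x)) //= big1 => [|y /negPf xy]; last by rewrite eq_sym xy mul0r.
    rewrite [X in _ + X](bigD1 (step l x + e)) //= big1 => [|y /negPf xy]; last by rewrite eq_sym xy mul0r.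
    by rewrite !eqxx !addr0.
  rewrite (bigD1 (costep z)) //= big1 => [|y /negPf xy]; last by rewrite eq_sym xy mulr0.
  rewrite eqxx addr0 dot2Dl sgn2D dot2_deltal mulr1n -dot2_costep /d.
  by case: (F2_cases (z 0 ord_max)) => ->; rewrite ?sgn2_0 ?sgn2_1 /=; ring.
have -> : char_poly (mixed_mx b) = char_poly W.
  have -> : char_poly W = char_poly W^T.
    by rewrite /char_poly -det_tr /char_poly_mx linearB /= tr_scalar_mx map_trmx.
  pose H := map_mx polyC (walsh m.+1).
  have : char_poly_mx (mixed_mx b) *m H = H *m char_poly_mx W^T.
    rewrite /char_poly_mx mulmxBl mulmxBr -!map_mxM KH; congr (_ - _).
    by rewrite scalar_mxC.
  move/(congr1 determinant); rewrite !det_mulmx mulrC; apply: mulfI.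
  by rewrite det_map_mx polyC_eq0 det_walsh_neq0.
have x1 : const_mx 1 != 0 :> T by apply/eqP=> /rowP/(_ ord0)/eqP; rewrite !mxE oner_eq0.
rewrite (char_poly_weighted_cycle costep_inj d (x0 := const_mx 1)) ?costep_fix //; last first.
  move=> x y; rewrite !costep_fix => x0 y0.
  by exists (findex costep x y); apply: iter_findex; apply: costep_transitive.
congr (_ * (_ - _)).
- rewrite (big_pred1 0) => [|x]; last by rewrite costep_fix.
  by rewrite /d mxE eqxx.
- rewrite -card_T1 -(cardC1 (0 : T)); congr ('X ^+ _); apply: eq_card => x.
  by rewrite !inE costep_fix.
(* The fixed character 0 has weight 1, so it may join the product. *)
have -> : \prod_(x | costep x != x) d x = \prod_x d x.
  rewrite [RHS](bigD1 0) //= {2}/d mxE eqxx mul1r; apply: eq_bigl => x.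
  by rewrite costep_fix.
rewrite (bigID (fun x : T => x 0 ord_max == 0)) /= [X in X * _]big1 => [|x xi]; last by rewrite /d xi.
rewrite mul1r (eq_bigr (fun=> 1 - b *+ 2)) => [|x /negPf xi]; last by rewrite /d xi.
rewrite prodr_const; congr ((_ ^+ _)%:P); apply: double_inj.
by rewrite -[RHS]mul2n -expnS -(card_coord_neq0 ord_max); congr _.*2; apply: eq_card => x.
Qed.

Definition perturb (S : {set V}) : {ffun V -> 'F_2} :=
  [ffun v => l v + (v \in S)%:R].

Lemma step_perturb S x :
  step (perturb S) x = step l x + (if tail x \in S then e else 0).
Proof.
apply/rowP=> i; rewrite [in RHS]mxE; case: (unliftP ord_max i) => [j ->|->].
  rewrite !step_lift; case: ifP; rewrite !mxE ?addr0 // => _.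
  by rewrite (eq_sym _ ord_max) (negPf (neq_lift _ _)) addr0.
rewrite !step_max ffunE addrA; congr (_ + _).
by case: ifP; rewrite !mxE ?eqxx.
Qed.

(** The state with tail [v] and first coordinate 0; the other state with that tail has its successor
    shifted by [e]. *)
Let lift_state (v : V) : T := \row_i (if unlift ord0 i is Some j then v 0 j else 0).

Let step_lift_tail x : step l x = step l (lift_state (tail x)) + x 0 ord0 *: e.
Proof.
have tK : tail (lift_state (tail x)) = tail x.
  by apply/rowP=> i; rewrite !mxE liftK mxE.
apply/rowP=> i; rewrite [in RHS]mxE; case: (unliftP ord_max i) => [j ->|->].
  rewrite !step_lift !mxE liftK !mxE (eq_sym _ ord_max) (negPf (neq_lift _ _)).
  by rewrite mulr0 addr0.
by rewrite !step_max tK !mxE unlift_none add0r !eqxx mulr1 addrC.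
Qed.

(* Perturbing [l] at [v] swaps the successors of the two states with tail [v]. *)
Let swap_col (v : V) : 'cV[rat]_#|{: T}| :=
  \col_i (sgn2 ((enum_val i : T) 0 ord0) *+ (tail (enum_val i) == v)).
Let swap_row (v : V) : 'rV[rat]_#|{: T}| :=
  \row_j ((step l (lift_state v) + e == enum_val j)%:R -
          (step l (lift_state v) == enum_val j)%:R).

(** Row [x] meets only the summand [v = tail x], and the sign in [swap_col] records which of the two
    successors belongs to [x]. Constant weights give [mixed_mx]; the indicator of [S] gives the
    permutation matrix of [perturb S]. *)
Let add_swaps (b : V -> rat) :
  fmx (fun x y : T => (step l x == y)%:R) + \sum_v b v *: (swap_col v *m swap_row v) =
  fmx (fun x y : T => (1 - b (tail x)) *+ (step l x == y) +
                      b (tail x) *+ (step l x + e == y)).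
Proof.
apply/matrixP=> i j; rewrite !mxE summxE.
set x : T := enum_val i; set y : T := enum_val j.
rewrite (bigD1 (tail x)) //= big1 => [|v /negPf xv]; last first.
  by rewrite !mxE big_ord1 !mxE eq_sym xv mulr0n mul0r mulr0.
rewrite !mxE big_ord1 !mxE eqxx -/x -/y addr0 step_lift_tail.
have [->|->] := F2_cases (x 0 ord0).
  by rewrite scale0r addr0 sgn2_0 mulr1n -[_ *+ _]mulr_natr -[b _ *+ _]mulr_natr; ring.
rewrite scale1r -addrA F2_addxx addr0 sgn2_1 mulr1n -[_ *+ _]mulr_natr -[b _ *+ _]mulr_natr.
by ring.
Qed.

Lemma char_poly_mixed_expand b :
  char_poly (mixed_mx b) =
  \sum_(S : {set V}) (b ^+ #|S| * (1 - b) ^+ (2 ^ m - #|S|))%:P *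
    char_poly (fmx (fun x y : T => (step (perturb S) x == y)%:R)).
Proof.
rewrite (esym (add_swaps (fun=> b)) : mixed_mx b = _) char_poly_add_sum_rank1; apply: eq_bigr => S _.
congr (_ * _); [congr polyC | congr char_poly].
  rewrite (bigID (mem S)) /= (eq_bigr (fun=> b)) => [|v ->] //.
  rewrite [X in _ * X](eq_bigr (fun=> 1 - b)) => [|v /negPf ->] //.
  rewrite !prodr_const -card_state -(cardsC S) addKn -cardsE.
  by congr (_ * _ ^+ _); apply: eq_card => v; rewrite !inE.
rewrite big_mkcond (eq_bigr (fun v => (v \in S)%:R *: (swap_col v *m swap_row v))).
  rewrite (add_swaps (fun v => (v \in S)%:R)); apply: eq_fmx => x y; rewrite step_perturb.
  by case: ifP => _; rewrite ?addr0 ?subrr ?subr0 ?mul0rn ?add0r ?addr0.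
by move=> v _; case: ifP; rewrite ?scale1r ?scale0r.
Qed.

(** Derivatives at 1 are compared in [char_poly_mixed_expand]. In [char_poly_mixed_mx] the factor
    ['X - 1] vanishes there, leaving the value of the other factor; each [S] contributes [2 ^ m.+1]
    or 0 by [deriv_char_poly_perm]. *)
Lemma sum_transitive_perturb (b : rat) :
  \sum_(S : {set V} | `[< generates_de_bruijn m.+1 (perturb S) >])
    b ^+ #|S| * (1 - b) ^+ (2 ^ m - #|S|) * (2 ^ m.+1)%:R = 1 - (1 - b *+ 2) ^+ (2 ^ m).
Proof.
have := congr1 (fun p => p^`().[1]) (char_poly_mixed_expand b).
rewrite char_poly_mixed_mx derivM hornerD !hornerM derivB derivX derivC subr0.
rewrite !hornerE expr1n => ->.
rewrite raddf_sum /= horner_sum big_mkcond; apply: eq_bigr => S _.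
rewrite derivM derivC mul0r add0r hornerM hornerC.
rewrite deriv_char_poly_perm; last 2 first.
- exact: step_inj.
- by rewrite card_state (ltn_exp2l 0).
rewrite card_state; case: ifPn => [/asboolP|/asboolP] H.
  by rewrite (generates_de_bruijn_transitive _).1.
by case: ifP => [|_]; rewrite ?mulr0 // => /(generates_de_bruijn_transitive _).2.
Qed.

(** Over the binary field a function is determined by the set where it differs from [l], so
    [perturb] is a bijection onto all feedback functions. *)
Lemma num_de_bruijnE k :
  num_de_bruijn m.+1 l k =
  #|[set S : {set V} | `[< generates_de_bruijn m.+1 (perturb S) >] && (#|S| == k)]|.
Proof.
have diffK S : [set x | perturb S x != l x] = S.
  apply/setP=> v; rewrite inE ffunE -subr_eq0 addrAC subrr add0r.
  by case: (v \in S).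
have inj : injective perturb by move=> S S' SS'; rewrite -(diffK S) SS' diffK.
rewrite -(card_imset _ inj); apply: eq_card => g.
rewrite !inE; apply/idP/imsetP => [/andP[gdb gk]|[S]]; last first.
  by rewrite inE => /andP[Sdb Sk] ->; rewrite Sdb diffK.
have gE : g = perturb [set x | g x != l x].
  apply/ffunP=> v; rewrite ffunE inE; have [->|gl] := eqVneq (g v) (l v); first by rewrite addr0.
  move: gl; have [->|->] := F2_cases (g v); have [->|->] := F2_cases (l v); rewrite ?eqxx // => _.
    by apply: val_inj.
  by rewrite add0r.
by exists [set x | g x != l x]; rewrite // inE -gE gdb.
Qed.

Lemma sum_num_de_bruijn (b : rat) :
  \sum_(k < (2 ^ m).+1)
    (num_de_bruijn m.+1 l k)%:R * (b ^+ k * (1 - b) ^+ (2 ^ m - k) * (2 ^ m.+1)%:R)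
  = 1 - (1 - b *+ 2) ^+ (2 ^ m).
Proof.
have leS (S : {set V}) : (#|S| <= 2 ^ m)%N by rewrite -card_state max_card.
rewrite -sum_transitive_perturb.
(* By [leS] the cardinalities fit in the ordinal type, so [inord] never takes its default value. *)
rewrite (partition_big (fun S : {set V} => inord #|S| : 'I_(2 ^ m).+1) xpredT) //=.
apply: eq_bigr => k _; rewrite num_de_bruijnE mulr_natl -sumr_const.
apply: eq_big => [S|S]; rewrite inE.
  by rewrite -val_eqE /= inordK ?ltnS.
by case/andP=> _ /eqP ->.
Qed.

End LinearRegister.

(** * From the polynomial identity to the counts *)

Lemma poly_eq_nat (p q : {poly rat}) :
  (forall n : nat, p.[n%:R] = q.[n%:R]) -> p = q.
Proof.
move=> pq; apply/eqP; rewrite -subr_eq0; apply: contraT => r0.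
(* The naturals below the size of [p - q] are distinct rationals and would be too many roots. *)
have := @max_poly_roots _ (p - q) [seq n%:R | n <- iota 0 (size (p - q))] r0.
rewrite size_map size_iota ltnn map_inj_uniq ?iota_uniq; last first.
  by move=> i j /eqP; rewrite eqr_nat => /eqP.
have -> : all (poly.root (p - q)) [seq n%:R | n <- iota 0 (size (p - q))].
  by apply/allP=> _ /mapP[n _ ->]; rewrite rootE hornerD hornerN pq subrr.
by move=> /(_ isT isT).
Qed.

Lemma coef_exp_1DcX (c : rat) n k : ((1 + c *: 'X) ^+ n)`_k = c ^+ k *+ 'C(n, k).
Proof.
rewrite exprDn coef_sum; under eq_bigr => i _.
  rewrite expr1n mul1r exprZn coefMn coefZ coefXn; over.
have [lt_kn|le_nk] := ltnP k n.+1.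
  rewrite (bigD1 (Ordinal lt_kn)) //= eqxx mulr1 big1 ?addr0 // => i.
  by rewrite -val_eqE /= eq_sym => /negPf ->; rewrite mulr0 mul0rn.
rewrite bin_small // mulr0n big1 // => i _.
by rewrite gtn_eqF ?mulr0 ?mul0rn // (leq_trans (ltn_ord i)).
Qed.

Section Count.
Variables (m : nat) (l : {linear 'rV['F_2]_m -> ('F_2)^o}).
Hypotheses (m_gt0 : (0 < m)%N) (l_mseq : generates_m_sequence m.+1 l).
Notation N := (2 ^ m)%N.
Notation a k := (num_de_bruijn m.+1 l k).

Lemma num_de_bruijn_poly :
  \poly_(k < N.+1) ((a k)%:R * (2 ^ m.+1)%:R) =
  (1 + 1 *: 'X) ^+ N - (1 + -1 *: 'X) ^+ N :> {poly rat}.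
Proof.
(* At natural [y] the denominator [1 + y] of [b] is nonzero. *)
apply: poly_eq_nat => y; rewrite horner_poly !hornerE mulN1r.
have y1 : 1 + y%:R != 0 :> rat by rewrite nat1r pnatr_eq0.
pose b : rat := y%:R / (1 + y%:R).
have by1 : b * (1 + y%:R) = y%:R by rewrite /b divfK.
have by2 : (1 - b) * (1 + y%:R) = 1 by rewrite mulrBl by1 mul1r addrK.
have := congr1 ( *%R^~ ((1 + y%:R) ^+ N)) (sum_num_de_bruijn m_gt0 l_mseq b).
rewrite mulrBl mul1r -exprMn (_ : (1 - b *+ 2) * _ = 1 - y%:R); last first.
  by rewrite mulrBl mulrnAl by1; ring.
move=> <-; rewrite mulr_suml; apply: eq_bigr => k _.
(* The cleared denominator is split into [k] factors for [b] and [N - k] for [1 - b]. *)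
have -> : (1 + y%:R) ^+ N = (1 + y%:R) ^+ k * (1 + y%:R) ^+ (N - k) :> rat.
  by rewrite -exprD subnKC // -ltnS.
rewrite -!mulrA; congr (_ * _).
transitivity ((2 ^ m.+1)%:R * ((b * (1 + y%:R)) ^+ k * ((1 - b) * (1 + y%:R)) ^+ (N - k))).
  by rewrite by1 by2 expr1n mulr1.
rewrite !exprMn.
by ring.
Qed.

Lemma num_de_bruijn_gt k : (N < k)%N -> a k = 0%N.
Proof.
move=> ltk; rewrite num_de_bruijnE; apply/eqP; rewrite cards_eq0; apply/eqP/setP=> S.
rewrite !inE; apply/negbTE/nandP; right; rewrite neq_ltn; apply/orP; left.
by apply: leq_ltn_trans ltk; rewrite -card_state max_card.
Qed.

(** [(odd k).*2] is [1 - (-1)^k] as a natural number, from the coefficients of the two binomial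
    powers. Beyond [N] both sides vanish. *)
Lemma num_de_bruijn_coef k :
  (a k * 2 ^ m.+1 = 'C(N, k) * (odd k).*2)%N.
Proof.
have [lekN|ltNk] := leqP k N; last by rewrite num_de_bruijn_gt // bin_small.
apply/eqP; rewrite -(eqr_nat rat) natrM; apply/eqP.
have := congr1 (fun p : {poly rat} => p`_k) num_de_bruijn_poly.
rewrite coef_poly ltnS lekN => ->; rewrite coefB !coef_exp_1DcX -mulrnBl expr1n -signr_odd.
rewrite natrM mulr_natl; congr (_ *+ _).
by case: (odd k).
Qed.

Lemma num_de_bruijn_even k : ~~ odd k -> a k = 0%N.
Proof.
move/negPf=> ek; have /eqP := num_de_bruijn_coef k.
by rewrite ek muln0 muln_eq0 expn_eq0 orbF => /eqP.
Qed.

Lemma num_de_bruijn_odd k : odd k -> (a k * N = 'C(N, k))%N.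
Proof.
move=> ok; have := num_de_bruijn_coef k; rewrite ok expnS.
by lia.
Qed.

(** At [y = 1] the identity reads [2 ^ m.+1] times the sum of all counts equals [2 ^ N]. The end
    terms 0 and [N] drop out, both indices being even. *)
Lemma num_de_bruijn_total : (\sum_(1 <= k < N) a k = 2 ^ (N - m.+1))%N.
Proof.
have := congr1 (fun p : {poly rat} => p.[1]) num_de_bruijn_poly.
rewrite horner_poly !hornerE subrr expr0n expn_eq0 /= subr0.
under eq_bigr => k _ do rewrite expr1n mulr1 -natrM.
rewrite -natr_sum -(natrD _ 1 1) -natrX => /eqP; rewrite eqr_nat -big_distrl /=.
rewrite -(big_mkord xpredT (fun k => a k)) big_ltn // big_nat_recr ?expn_gt0 //=.
rewrite !num_de_bruijn_even ?oddX ?(gtn_eqF m_gt0) // add0n addn0.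
have lem : (m.+1 <= N)%N by apply: ltn_expl.
by rewrite -{2}(subnK lem) expnD eqn_pmul2r ?expn_gt0 // => /eqP.
Qed.

End Count.

Theorem mainTheorem1 (n : nat) (l : {linear 'rV['F_2]_n.-1 -> ('F_2)^o}) :
  (2 <= n)%N ->
  generates_m_sequence n l ->
  num_de_bruijn n l 1 = 1%N /\
  (forall k : nat, ~~ odd k -> num_de_bruijn n l k = 0%N) /\
  (forall k : nat, odd k -> (3 <= k <= 2 ^ (n - 1) - 1)%N ->
     (num_de_bruijn n l k)%:R =
       (\prod_(1 <= i < k) ((2 ^ (n - 1))%N%:R - i%:R)) / (k`!)%:R :> rat) /\
  num_de_bruijn n l (2 ^ (n - 1) - 1) = 1%N /\
  (forall k : nat, (2 ^ (n - 1) - 1 < k)%N -> num_de_bruijn n l k = 0%N) /\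
  (\sum_(1 <= k < 2 ^ (n - 1)) num_de_bruijn n l k = 2 ^ (2 ^ (n - 1) - n))%N.
Proof.
case: n l => [|m] // l; rewrite subSS subn0 ltnS => m_gt0 l_mseq.
have N_gt0 : (0 < 2 ^ m)%N by rewrite expn_gt0.
have N_even : ~~ odd (2 ^ m) by rewrite oddX (gtn_eqF m_gt0).
split; [|split; [|split; [|split; [|split]]]].
- have := num_de_bruijn_odd m_gt0 l_mseq (k := 1) isT.
  by rewrite bin1 -{2}[(2 ^ m)%N]mul1n => /eqP; rewrite eqn_pmul2r // => /eqP.
- exact: num_de_bruijn_even.
- move=> k k_odd /andP[k3 kN].
  have lekN : (k <= 2 ^ m)%N by apply: leq_trans kN (leq_subr _ _).
  apply: (canRL (mulfK _)); first by rewrite pnatr_eq0 -lt0n fact_gt0.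
  have := congr1 (muln^~ k`!) (num_de_bruijn_odd m_gt0 l_mseq k_odd).
  rewrite bin_ffact ffact_prod mulnAC => /eqP; rewrite -(eqr_nat rat) natrM natr_prod.
  (* The factor for [i = 0] of the falling factorial is [2 ^ m], which cancels against the one on
     the left. *)
  rewrite -(big_mkord xpredT (fun i => (2 ^ m - i)%:R)) big_ltn ?(ltn_trans _ k3) // subn0 mulrC.
  rewrite (inj_eq (mulfI _)) ?pnatr_eq0 -?lt0n // natrM => /eqP ->.
  by apply: eq_big_nat => i /andP[_ ik]; rewrite natrB // (leq_trans (ltnW ik)).
- have oN1 : odd (2 ^ m - 1) by rewrite oddB // (negPf N_even).
  have := num_de_bruijn_odd m_gt0 l_mseq oN1.
  by rewrite bin_sub // bin1 => /esym/eqP; rewrite -{1}[(2 ^ m)%N]mul1n eqn_pmul2r // => /eqP.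
(* The boundary index [k = 2 ^ m] is settled by parity, larger ones by cardinality. *)
- move=> k; rewrite subn1 prednK // leq_eqVlt => /predU1P[<-|]; last exact: num_de_bruijn_gt.
  exact: num_de_bruijn_even.
exact: num_de_bruijn_total.
Qed.
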